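(* Let $(T_i,x_i)_{i=1}^\infty$ be a sequence of trees, each with a chosen base vertex $x_i$. Then the restricted product $\times_{i=1}^\infty T_i$ has asymptotic property C.
   Context: A tree is a connected acyclic graph, regarded as a metric space on its vertex set with the shortest path metric. Given a sequence of pointed metric spaces $(X_i,x_i)_{i\ge1}$, the restricted product $\times_{i=1}^\infty X_i$ is the set of sequences $(a_i)_{i\ge1}$ with $a_i\in X_i$ for all $i$ and $a_i=x_i$ for all but finitely many $i$, equipped with the metric $d((a_i),(b_i))=\sum_{i=1}^\infty i\cdot d(a_i,b_i)$. For $R>0$, a family $\mathcal U$ of nonempty subsets of a metric space is $R$-disjoint if $d(A,B)>R$ for all distinct $A,B\in\mathcal U$, where $d(A,B)=\inf\{d(a,b):a\in A,b\in B\}$; it is uniformly bounded if $\sup\{\operatorname{diam}U:U\in\mathcal U\}<\infty$. A metric space $X$ has asymptotic property C if for every sequence $R_0\le R_1\le R_2\le\cdots$ of positive reals there exist $n\ge0$ and uniformly bounded $R_i$-disjoint families $\mathcal U_i$ ($i=0,\dots,n$) of subsets of $X$ such that $\bigcup_{i=0}^n\mathcal U_i$ covers $X$. *)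

(* Defs.v *)
From Stdlib Require Import Reals List ClassicalEpsilon.
Import ListNotations.
Open Scope R_scope.

Inductive Walk {V : Type} (adj : V -> V -> Prop) : V -> V -> nat -> Prop :=
| walk_nil : forall x, Walk adj x x 0
| walk_cons : forall x y z n, adj x y -> Walk adj y z n -> Walk adj x z (S n).

Fixpoint chain {V : Type} (adj : V -> V -> Prop) (l : list V) : Prop :=
  match l with
  | [] => True
  | x :: l' => match l' with
               | [] => True
               | y :: _ => adj x y /\ chain adj l'
               end
  end.

Definition is_cycle {V : Type} (adj : V -> V -> Prop) (c : list V) : Prop :=
  match c with
  | [] => False
  | v0 :: _ => 3 <= length c /\ NoDup c /\ chain adj c /\ adj (last c v0) v0
  end%nat.

Definition simple_graph {V : Type} (adj : V -> V -> Prop) : Prop :=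
  (forall x y, adj x y -> adj y x) /\ (forall x, ~ adj x x).

Definition connected {V : Type} (adj : V -> V -> Prop) : Prop :=
  forall x y, exists n, Walk adj x y n.

Definition acyclic {V : Type} (adj : V -> V -> Prop) : Prop :=
  forall c, ~ is_cycle adj c.

Definition is_tree {V : Type} (adj : V -> V -> Prop) : Prop :=
  simple_graph adj /\ connected adj /\ acyclic adj.

Definition is_graph_dist {V : Type} (adj : V -> V -> Prop) (x y : V) (n : nat) : Prop :=
  Walk adj x y n /\ forall m, Walk adj x y m -> (n <= m)%nat.

Definition graph_dist {V : Type} (adj : V -> V -> Prop) (x y : V) : R :=
  INR (epsilon (inhabits 0%nat) (is_graph_dist adj x y)).

(* d(A,B) > r, where d(A,B) = inf {d(a,b) : a in A, b in B}:
   the infimum exceeds r iff some lower bound of the set exceeds r *)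
Definition set_dist_gt {X : Type} (d : X -> X -> R) (A B : X -> Prop) (r : R) : Prop :=
  exists s, r < s /\ forall a b, A a -> B b -> s <= d a b.

Definition r_disjoint {X : Type} (d : X -> X -> R) (r : R) (F : (X -> Prop) -> Prop) : Prop :=
  (forall A, F A -> exists a, A a) /\
  (forall A B, F A -> F B -> A <> B -> set_dist_gt d A B r).

Definition unif_bounded {X : Type} (d : X -> X -> R) (F : (X -> Prop) -> Prop) : Prop :=
  exists M, forall A, F A -> forall a b, A a -> A b -> d a b <= M.

Definition asymptotic_property_C {X : Type} (d : X -> X -> R) : Prop :=
  forall Rs : nat -> R,
    (forall i, 0 < Rs i) -> (forall i, Rs i <= Rs (S i)) ->
    exists (n : nat) (U : nat -> (X -> Prop) -> Prop),
      (forall i, (i <= n)%nat -> unif_bounded d (U i) /\ r_disjoint d (Rs i) (U i)) /\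
      (forall x, exists i A, (i <= n)%nat /\ U i A /\ A x).

(** * Restricted product of pointed metric spaces.
    Coordinate index k : nat stands for i = k+1 of the paper. *)
Definition restricted_product (V : nat -> Type) (base : forall k, V k) : Type :=
  { a : forall k, V k | exists N, forall k, (N <= k)%nat -> a k = base k }.

Definition rp_dist (V : nat -> Type) (base : forall k, V k)
  (d : forall k, V k -> V k -> R) (a b : restricted_product V base) : R :=
  epsilon (inhabits 0)
    (infinite_sum (fun k => INR (S k) * d k (proj1_sig a k) (proj1_sig b k))).

(* Main.v *)
Require Import Defs.
From Stdlib Require Import Reals List ClassicalEpsilon Lia Lra ZArith Relations Wf_nat.
From Stdlib Require Import FunctionalExtensionality PropExtensionality.
Import ListNotations.
Open Scope R_scope.

(** Let [x_k] be the distance of the [k]-th coordinate to its base vertex.  In a tree, a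
    coarsely connected set whose heights stay in a bounded window is bounded, so it
    suffices to cut the integer sequences [(x_k)] into strata whose coarse components are
    bounded.

    Let [K = r_0 >= R_0].  A step of length at most [r_0] cannot change a coordinate
    [k >= K], because of the weight [k + 1]; so at scale [r_0] only the slices [Z^K] over
    a fixed [y = (x_k)_{k >= K}] matter, and each slice is cut into cells by the walls
    [x_i = - offset y mod period], [i < K].  The offset is a positional expansion of [y],
    so that parallel walls over distinct nearby [y] are far apart.  Hence, at a slowly
    growing scale, the walls near a point, over all nearby [y], have pairwise distinct
    directions.  Stratum [j] consists of the points which are near [j] directions of walls
    but not near [j + 1] at the next scale.  Along a coarsely connected part of stratum
    [j] the [j] walls cannot change, which bounds these [j] coordinates and [y]; the
    remaining coordinates cannot cross a wall.  No point is near walls of [K + 1]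
    directions, so the strata [0, ..., K] suffice. *)

(** * Heights in a rooted tree *)

(** [graph_dist] is [INR] of this number; staying in [nat] leaves the inequalities to [lia]. *)
Definition walk_dist {V : Type} (adj : V -> V -> Prop) (x y : V) : nat :=
  epsilon (inhabits 0%nat) (is_graph_dist adj x y).

Lemma walk_dist_spec {V : Type} (adj : V -> V -> Prop) (x y : V) :
  connected adj -> is_graph_dist adj x y (walk_dist adj x y).
Proof.
  intros Hc. unfold walk_dist. apply epsilon_spec.
  destruct (Hc x y) as [n Hn].
  destruct (dec_inh_nat_subset_has_unique_least_element (Walk adj x y)) as [m [Hm _]].
  - intros k. apply classic.
  - now exists n.
  - exists m. split; apply Hm.
Qed.

Lemma Walk_trans {V : Type} (adj : V -> V -> Prop) (x y z : V) (m n : nat) :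
  Walk adj x y m -> Walk adj y z n -> Walk adj x z (m + n).
Proof.
  induction 1; intros Hn; simpl; [assumption|].
  econstructor; eauto.
Qed.

Lemma Walk_sym {V : Type} (adj : V -> V -> Prop) (x y : V) (n : nat) :
  (forall x y, adj x y -> adj y x) -> Walk adj x y n -> Walk adj y x n.
Proof.
  intros Hs. induction 1 as [|x y z n Hxy _ IH]; [constructor|].
  replace (S n) with (n + 1)%nat by lia.
  eapply Walk_trans; [exact IH|].
  econstructor; [apply Hs; exact Hxy|constructor].
Qed.

Lemma Walk_incl {V : Type} (adj adj' : V -> V -> Prop) (x y : V) (n : nat) :
  (forall x y, adj x y -> adj' x y) -> Walk adj x y n -> Walk adj' x y n.
Proof. intros Hi. induction 1; econstructor; eauto. Qed.

Lemma walk_dist_le {V : Type} (adj : V -> V -> Prop) (x y : V) (n : nat) :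
  connected adj -> Walk adj x y n -> (walk_dist adj x y <= n)%nat.
Proof. intros Hc. apply (walk_dist_spec adj x y Hc). Qed.

Lemma walk_dist_sym {V : Type} (adj : V -> V -> Prop) (x y : V) :
  connected adj -> (forall x y, adj x y -> adj y x) ->
  walk_dist adj x y = walk_dist adj y x.
Proof.
  intros Hc Hs.
  apply Nat.le_antisymm; apply walk_dist_le; trivial; apply Walk_sym; trivial;
    now apply walk_dist_spec.
Qed.

Lemma walk_dist_triangle {V : Type} (adj : V -> V -> Prop) (x y z : V) :
  connected adj ->
  (walk_dist adj x z <= walk_dist adj x y + walk_dist adj y z)%nat.
Proof.
  intros Hc. apply walk_dist_le; trivial.
  eapply Walk_trans; now apply walk_dist_spec.
Qed.

Lemma walk_dist_refl {V : Type} (adj : V -> V -> Prop) (x : V) :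
  connected adj -> walk_dist adj x x = 0%nat.
Proof.
  intros Hc. assert (H := walk_dist_le adj x x 0 Hc (walk_nil _ x)). lia.
Qed.

Lemma walk_dist_0 {V : Type} (adj : V -> V -> Prop) (x y : V) :
  connected adj -> walk_dist adj x y = 0%nat -> x = y.
Proof.
  intros Hc H0. destruct (walk_dist_spec adj x y Hc) as [H _].
  rewrite H0 in H. now inversion H.
Qed.

Lemma walk_dist_adj {V : Type} (adj : V -> V -> Prop) (o x y : V) :
  connected adj -> adj x y -> (walk_dist adj o y <= S (walk_dist adj o x))%nat.
Proof.
  intros Hc Hxy.
  assert (H := walk_dist_triangle adj o x y Hc).
  assert (H1 : Walk adj x y 1) by (econstructor; [exact Hxy|constructor]).
  apply (walk_dist_le adj x y 1 Hc) in H1. lia.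
Qed.

Lemma exists_parent {V : Type} (adj : V -> V -> Prop) (o v : V) (n : nat) :
  simple_graph adj -> connected adj -> walk_dist adj o v = S n ->
  exists p, adj v p /\ walk_dist adj o p = n.
Proof.
  intros [Hs _] Hc Hv.
  destruct (walk_dist_spec adj o v Hc) as [Hw _]. rewrite Hv in Hw.
  apply Walk_sym in Hw; trivial.
  inversion Hw as [|? p ? ? Hvp Hpo]; subst.
  exists p. split; trivial.
  apply Walk_sym in Hpo; trivial. apply (walk_dist_le adj o p n Hc) in Hpo.
  assert (H := walk_dist_adj adj o p v Hc (Hs _ _ Hvp)). lia.
Qed.

(** * Simple paths and levels in a tree *)

Lemma last_cons {A : Type} (x d : A) (l : list A) : last (x :: l) d = last l x.
Proof.
  revert x d. induction l as [|y l IH]; intros x d; [reflexivity|].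
  change (last (y :: l) d = last (y :: l) x). now rewrite (IH y d), (IH y x).
Qed.

Lemma chain_rcons {V : Type} (adj : V -> V -> Prop) (l : list V) (x y : V) :
  chain adj (l ++ [x]) -> adj x y -> chain adj ((l ++ [x]) ++ [y]).
Proof.
  intros Hl Hxy. induction l as [|a l IH]; [now split|].
  destruct l as [|b l]; simpl in *; intuition.
Qed.

Lemma chain_suffix {V : Type} (adj : V -> V -> Prop) (l l' : list V) :
  chain adj (l ++ l') -> chain adj l'.
Proof.
  induction l as [|a l IH]; [trivial|]. intros H. apply IH.
  simpl in H. destruct (l ++ l'); simpl; intuition.
Qed.

Lemma chain_incl {V : Type} (adj adj' : V -> V -> Prop) (l : list V) :
  (forall x y, adj x y -> adj' x y) -> chain adj l -> chain adj' l.
Proof.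
  intros Hi. induction l as [|a l IH]; [trivial|].
  destruct l as [|b l]; [trivial|]. intros [H1 H2]. split; auto.
Qed.

Lemma chain_Forall {V : Type} (adj : V -> V -> Prop) (Q : V -> Prop) (x : V) (l : list V) :
  (forall x y, adj x y -> Q y) -> chain adj (x :: l) -> Forall Q l.
Proof.
  intros Hq. revert x. induction l as [|a l IH]; intros x; [constructor|].
  intros [H1 H2]. constructor; eauto.
Qed.

Lemma Walk_simple_path {V : Type} (adj : V -> V -> Prop) (x z : V) (n : nat) :
  Walk adj x z n ->
  exists l, NoDup (x :: l) /\ chain adj (x :: l) /\ last l x = z.
Proof.
  induction 1 as [x|x y z n Hxy _ (l & Hnd & Hch & Hl)].
  - exists []. repeat split. repeat constructor. easy.
  (* If [x] recurs on the path from [y], the part before that occurrence is a detour and is cut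
     off. *)
  - destruct (classic (In x (y :: l))) as [Hin|Hnin].
    + destruct (in_split x (y :: l) Hin) as (l1 & l2 & E).
      exists l2. rewrite E in Hnd, Hch. repeat split.
      * revert Hnd. clear. induction l1; [trivial|]. inversion 1; auto.
      * eapply chain_suffix, Hch.
      * rewrite <- Hl, <- (last_cons y x l), <- (last_cons x x l2), E.
        clear. induction l1 as [|a l1 IH]; [reflexivity|].
        rewrite IH. destruct l1; reflexivity.
    + exists (y :: l). repeat split; trivial.
      * now constructor.
      * now rewrite last_cons.
Qed.

(* Prolonging both ends of the path towards the root either closes up a cycle or
   gives a path of the same kind one level lower. *)
Lemma no_path_above_level {V : Type} (adj : V -> V -> Prop) (o : V) (h : nat) :
  is_tree adj -> forall (m : list V) (u u' : V),
  walk_dist adj o u = h -> walk_dist adj o u' = h ->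
  NoDup (u :: m ++ [u']) -> chain adj (u :: m ++ [u']) ->
  Forall (fun v => (h <= walk_dist adj o v)%nat) m -> False.
Proof.
  intros ([Hs Hirr] & Hc & Hac).
  induction h as [|h IH]; intros m u u' Hu Hu' Hnd Hch Hm.
  - apply walk_dist_0 in Hu, Hu'; trivial. subst u u'.
    inversion Hnd as [|? ? Hn _]; subst. apply Hn, in_or_app. right; now left.
  - destruct (exists_parent adj o u h (conj Hs Hirr) Hc Hu) as (p & Hup & Hp).
    destruct (exists_parent adj o u' h (conj Hs Hirr) Hc Hu') as (p' & Hup' & Hp').
    assert (Hhigh : forall v, In v (u :: m ++ [u']) -> (S h <= walk_dist adj o v)%nat).
    { intros v [<-|Hv]; [lia|]. apply in_app_or in Hv as [Hv|[<-|[]]]; [|lia].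
      rewrite Forall_forall in Hm. now apply Hm. }
    assert (Hpn : NoDup (p :: u :: m ++ [u'])).
    { constructor; trivial. intros Hin. apply Hhigh in Hin. lia. }
    destruct (classic (p = p')) as [<-|Hpp'].
    + apply (Hac (p :: u :: m ++ [u'])). split; [|split; [|split]]; trivial.
      * simpl. rewrite length_app. simpl. lia.
      * split; [now apply Hs|exact Hch].
      * change (p :: u :: m ++ [u']) with ((p :: u :: m) ++ [u']).
        now rewrite last_last.
    + apply (IH (u :: m ++ [u']) p p'); trivial.
      * change (p :: (u :: m ++ [u']) ++ [p']) with ((p :: u :: m ++ [u']) ++ [p']).
        apply NoDup_app; trivial.
        -- repeat constructor. easy.
        -- intros a [<-|Ha] [E|[]]; [now apply Hpp'|].
           subst a. apply Hhigh in Ha. lia.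
      * change (p :: (u :: m ++ [u']) ++ [p']) with (((p :: u :: m) ++ [u']) ++ [p']).
        apply chain_rcons; trivial. split; [now apply Hs|exact Hch].
      * apply Forall_forall. intros v Hv. apply Hhigh in Hv. lia.
Qed.

(** The subgraph induced on heights at least [h]. An empty walk in it says nothing about the height
    of its vertex. *)
Definition adj_above {V : Type} (adj : V -> V -> Prop) (o : V) (h : nat) (x y : V) : Prop :=
  adj x y /\ (h <= walk_dist adj o x)%nat /\ (h <= walk_dist adj o y)%nat.

Lemma adj_above_sym {V : Type} (adj : V -> V -> Prop) (o : V) (h : nat) :
  simple_graph adj -> forall x y, adj_above adj o h x y -> adj_above adj o h y x.
Proof. intros [Hs _] x y (H & ? & ?). repeat split; auto. Qed.

(** Otherwise a simple path extracted from the walk would join two distinct vertices of one level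
    without going below it, which [no_path_above_level] excludes. *)
Lemma walk_above_level_eq {V : Type} (adj : V -> V -> Prop) (o u u' : V) (n : nat) :
  is_tree adj -> walk_dist adj o u' = walk_dist adj o u ->
  Walk (adj_above adj o (walk_dist adj o u)) u u' n -> u = u'.
Proof.
  intros Ht Huu' Hw. apply NNPP. intros Hne.
  apply Walk_simple_path in Hw as (l & Hnd & Hch & Hl).
  destruct l as [|a l0 _] using rev_ind; [now apply Hne|].
  rewrite last_last in Hl. subst a.
  apply (no_path_above_level adj o _ Ht l0 u u' eq_refl Huu' Hnd).
  - eapply chain_incl, Hch. intros x y H. apply H.
  - apply chain_Forall with (Q := fun v => (walk_dist adj o u <= walk_dist adj o v)%nat) in Hch.
    + apply Forall_app in Hch. apply Hch.
    + intros x y H. apply H.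
Qed.

Lemma descend_to_level {V : Type} (adj : V -> V -> Prop) (o : V) (h n : nat) :
  is_tree adj -> forall v, walk_dist adj o v = (h + n)%nat ->
  exists u, Walk (adj_above adj o h) v u n /\ walk_dist adj o u = h.
Proof.
  intros (Hs & Hc & _). induction n as [|n IH]; intros v Hv.
  - exists v. split; [constructor|lia].
  - destruct (exists_parent adj o v (h + n) Hs Hc) as (p & Hvp & Hp); [lia|].
    destruct (IH p Hp) as (u & Hu & Hh). exists u. split; trivial.
    econstructor; [|exact Hu]. repeat split; trivial; lia.
Qed.

Lemma walk_stays_above {V : Type} (adj : V -> V -> Prop) (o x y : V) (h n : nat) :
  is_tree adj -> Walk adj x y n -> (h <= walk_dist adj o x - n)%nat ->
  Walk (adj_above adj o h) x y n.
Proof.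
  intros ([Hs _] & Hc & _). induction 1 as [|x y z n Hxy _ IH]; intros Hh; [constructor|].
  assert (H := walk_dist_adj adj o y x Hc (Hs _ _ Hxy)).
  econstructor; [|apply IH; lia]. repeat split; trivial; lia.
Qed.

(** Descending from [x] and from [y] to level [h] ends at the same vertex by [walk_above_level_eq],
    so the two descents join up to a walk from [x] to [y]. *)
Lemma walk_dist_above {V : Type} (adj : V -> V -> Prop) (o x y : V) (h n : nat) :
  is_tree adj -> Walk (adj_above adj o h) x y n ->
  (h <= walk_dist adj o x)%nat -> (h <= walk_dist adj o y)%nat ->
  (walk_dist adj x y <= (walk_dist adj o x - h) + (walk_dist adj o y - h))%nat.
Proof.
  intros Ht Hw Hx Hy.
  destruct (descend_to_level adj o h (walk_dist adj o x - h) Ht x) as (u & Hu & Eu); [lia|].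
  destruct (descend_to_level adj o h (walk_dist adj o y - h) Ht y) as (u' & Hu' & Eu'); [lia|].
  assert (Hsy := adj_above_sym adj o h (proj1 Ht)).
  assert (u = u') as <-.
  { eapply (walk_above_level_eq adj o); trivial; [congruence|].
    rewrite Eu. eapply Walk_trans; [apply Walk_sym; [exact Hsy|exact Hu]|].
    eapply Walk_trans; [exact Hw|exact Hu']. }
  apply walk_dist_le; [apply Ht|].
  eapply Walk_trans; [|apply Walk_sym; [apply Ht|]];
    (eapply Walk_incl; [|eassumption]); intros a b H; apply H.
Qed.

(** * Strata of integer sequences *)

(** The sum of [B^(m+1) * w (k+m)] over [m < n]. Exponents start at 1, so every value is a multiple
    of [B]. *)
Fixpoint radix (B : Z) (n : nat) (w : nat -> Z) (k : nat) : Z :=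
  match n with
  | O => 0
  | S n' => B * (w k + radix B n' w (S k))
  end%Z.

Fixpoint radix_bound (B s : Z) (n : nat) : Z :=
  match n with
  | O => 0
  | S n' => B * (s + radix_bound B s n')
  end%Z.

Lemma radix_sub (B : Z) (n : nat) (w w' : nat -> Z) (k : nat) :
  radix B n (fun i => w i - w' i)%Z k = (radix B n w k - radix B n w' k)%Z.
Proof. revert k. induction n; intros k; simpl; [lia|]. rewrite IHn. ring. Qed.

Lemma radix_ext (B : Z) (n : nat) (w w' : nat -> Z) (k : nat) :
  (forall i, (k <= i < k + n)%nat -> w i = w' i) -> radix B n w k = radix B n w' k.
Proof.
  revert k. induction n; intros k H; simpl; [reflexivity|].
  rewrite (H k), IHn; trivial; [|lia]. intros i Hi. apply H. lia.
Qed.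

Lemma radix_abs_le (B s : Z) (n : nat) (w : nat -> Z) (k : nat) :
  (0 <= B)%Z -> (forall i, (k <= i < k + n)%nat -> Z.abs (w i) <= s)%Z ->
  (Z.abs (radix B n w k) <= radix_bound B s n)%Z.
Proof.
  intros HB. revert k. induction n; intros k H; simpl; [lia|].
  rewrite Z.abs_mul, (Z.abs_eq B) by trivial.
  apply Z.mul_le_mono_nonneg_l; trivial.
  assert (H1 := H k ltac:(lia)).
  assert (H2 : (Z.abs (radix B n w (S k)) <= radix_bound B s n)%Z)
    by (apply IHn; intros i Hi; apply H; lia).
  lia.
Qed.

(** A multiple of [B] smaller than [B] in absolute value is 0. Hence the tail equals [- w k], which
    is again at most [s], and induction applies to the tail. *)
Lemma radix_small_eq0 (B s : Z) (n : nat) (w : nat -> Z) (k : nat) :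
  (s < B)%Z -> (forall i, (k <= i < k + n)%nat -> Z.abs (w i) <= s)%Z ->
  (Z.abs (radix B n w k) <= s)%Z ->
  forall i, (k <= i < k + n)%nat -> w i = 0%Z.
Proof.
  intros HB. revert k. induction n; intros k H Hr i Hi; [lia|].
  simpl in Hr.
  assert (Hz : (w k + radix B n w (S k) = 0)%Z) by nia.
  assert (Hk := H k ltac:(lia)).
  assert (Hrest : forall i, (S k <= i < S k + n)%nat -> w i = 0%Z).
  { apply IHn; [intros j Hj; apply H; lia|lia]. }
  destruct (Nat.eq_dec i k) as [->|]; [|apply Hrest; lia].
  rewrite (radix_ext B n w (fun _ => 0%Z) (S k)) in Hz by exact Hrest.
  assert (E : forall m j, radix B m (fun _ => 0%Z) j = 0%Z)
    by (induction m; intros j; simpl; [|rewrite IHm]; lia).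
  rewrite E in Hz. lia.
Qed.

(** * Walls and their rigidity *)

Definition offset (K s : nat) (u : nat -> Z) : Z :=
  radix (Z.of_nat s + 1) (s - K) u K.

(** Offsets of [s]-close points differ by at most the [radix_bound] term. The further [s + 1] forces
    equal [q] on walls over such points that are within [s] of each other. *)
Definition period (K s : nat) : Z :=
  (radix_bound (Z.of_nat s + 1) (Z.of_nat s) (s - K) + Z.of_nat s + 1)%Z.

Lemma period_gt (K s : nat) : (Z.of_nat s < period K s)%Z.
Proof.
  unfold period. enough (H : forall n, (0 <= radix_bound (Z.of_nat s + 1) (Z.of_nat s) n)%Z)
    by (specialize (H (s - K)%nat); lia).
  induction n; simpl; nia.
Qed.

(* Think of [x] as a point [(x_i)_{i<K}] of [Z^K] sitting over [y = (x_k)_{K<=k<s}];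
   over [y] the walls are the hyperplanes [x_i = - offset y mod period].  Then [x] is
   within [c] of a wall in direction [i] belonging to some [u] that is [c]-close to [y]. *)
Definition near_wall (K s c : nat) (x : nat -> Z) (i : nat) (u : nat -> Z) (q : Z) : Prop :=
  ((forall k, (K <= k < s)%nat -> Z.abs (u k - x k) <= Z.of_nat c) /\
   Z.abs (x i + offset K s u - period K s * q) <= Z.of_nat c)%Z.

Definition blocked (K s c : nat) (x : nat -> Z) (i : nat) : Prop :=
  exists u q, near_wall K s c x i u q.

(** The two walls are within [2c + r <= s] of each other, over base points that are equally close.
    The size of [period] gives [q = q']; then the offsets differ by at most [s], and
    [radix_small_eq0] gives [u = u'] on the digits that count. *)
Lemma near_wall_rigid (K s c r : nat) (x x' : nat -> Z) (i : nat)
  (u u' : nat -> Z) (q q' : Z) :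
  (2 * c + r <= s)%nat -> (forall k, Z.abs (x k - x' k) <= Z.of_nat r)%Z ->
  near_wall K s c x i u q -> near_wall K s c x' i u' q' ->
  near_wall K s c x' i u q.
Proof.
  intros Hs Hx [Hu Hq] [Hu' Hq'].
  assert (Huu : forall k, (K <= k < K + (s - K))%nat ->
                          (Z.abs (u k - u' k) <= Z.of_nat s)%Z).
  { intros k Hk. specialize (Hx k). specialize (Hu k ltac:(lia)).
    specialize (Hu' k ltac:(lia)). lia. }
  assert (Hb := radix_abs_le (Z.of_nat s + 1) (Z.of_nat s) (s - K) _ K ltac:(lia) Huu).
  assert (Hz := radix_small_eq0 (Z.of_nat s + 1) (Z.of_nat s) (s - K) _ K ltac:(lia) Huu).
  rewrite radix_sub in Hb, Hz.
  fold (offset K s u) (offset K s u') in Hb, Hz.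
  specialize (Hx i).
  assert (Hd : (Z.abs (offset K s u - offset K s u' - period K s * (q - q')) <= Z.of_nat s)%Z)
    by lia.
  assert (Hp : (period K s > radix_bound (Z.of_nat s + 1) (Z.of_nat s) (s - K) + Z.of_nat s)%Z)
    by (unfold period; lia).
  assert (q = q') as <-.
  { assert (Hqq : (Z.abs (period K s * (q - q')) < period K s)%Z) by lia.
    assert (period K s > 0)%Z by (pose proof (period_gt K s); lia).
    rewrite Z.abs_mul in Hqq. nia. }
  assert (He : forall k, (K <= k < K + (s - K))%nat -> u k = u' k).
  { intros k Hk. cut (u k - u' k = 0)%Z; [lia|]. apply Hz; trivial. lia. }
  split.
  - intros k Hk. rewrite He by lia. now apply Hu'.
  - unfold offset at 1. rewrite (radix_ext _ _ u u') by exact He. exact Hq'.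
Qed.

Lemma blocked_step (K s c r c' : nat) (x x' : nat -> Z) (i : nat) :
  (c + r <= c')%nat -> (forall k, Z.abs (x k - x' k) <= Z.of_nat r)%Z ->
  blocked K s c x i -> blocked K s c' x' i.
Proof.
  intros Hc Hx (u & q & Hu & Hq). exists u, q. split.
  - intros k Hk. specialize (Hu k Hk). specialize (Hx k). lia.
  - specialize (Hx i). lia.
Qed.

(** * Strata by the number of blocked directions *)

Fixpoint count (P : nat -> Prop) (n : nat) : nat :=
  match n with
  | O => O
  | S n' => (if excluded_middle_informative (P n') then 1 else 0) + count P n'
  end%nat.

Lemma count_le (P : nat -> Prop) (n : nat) : (count P n <= n)%nat.
Proof. induction n; simpl; [lia|]. destruct excluded_middle_informative; lia. Qed.

Lemma count_pos (P : nat -> Prop) (n : nat) :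
  (0 < count P n)%nat -> exists i, (i < n)%nat /\ P i.
Proof.
  induction n; simpl; [lia|]. destruct excluded_middle_informative as [H|H].
  - intros _. exists n. auto.
  - intros Hp. destruct (IHn Hp) as (i & ? & ?). exists i. auto.
Qed.

Lemma count_incl (P Q : nat -> Prop) (n : nat) :
  (forall i, (i < n)%nat -> P i -> Q i) -> (count P n <= count Q n)%nat.
Proof.
  induction n; intros H; simpl; [lia|].
  assert (count P n <= count Q n)%nat by auto.
  destruct (excluded_middle_informative (P n)) as [p|];
    destruct (excluded_middle_informative (Q n)) as [|nq]; try lia.
  exfalso. apply nq, H; auto.
Qed.

Lemma count_incl_rev (P Q : nat -> Prop) (n : nat) :
  (forall i, (i < n)%nat -> P i -> Q i) -> (count Q n <= count P n)%nat ->
  forall i, (i < n)%nat -> Q i -> P i.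
Proof.
  induction n; intros H Hc i Hi Qi; simpl in *; [lia|].
  assert (count P n <= count Q n)%nat by (apply count_incl; auto).
  destruct (excluded_middle_informative (P n)) as [p|np];
    destruct (excluded_middle_informative (Q n)) as [q|nq]; try lia.
  - destruct (Nat.eq_dec i n) as [->|]; [trivial|]. apply IHn; auto; lia.
  - exfalso. apply nq, H; auto.
  - destruct (Nat.eq_dec i n) as [->|]; [easy|]. apply IHn; auto; lia.
Qed.

(** [scale r (S j)] is the [2c + r] of [near_wall_rigid] for [c = scale r j], and thus also covers
    the [c + r] of [blocked_step]. *)
Fixpoint scale (r : nat -> nat) (j : nat) : nat :=
  match j with
  | O => O
  | S j' => 2 * scale r j' + r j'
  end%nat.

Lemma scale_mono (r : nat -> nat) (i j : nat) :
  (i <= j)%nat -> (scale r i <= scale r j)%nat.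
Proof. induction 1; simpl; lia. Qed.

Definition stratum (r : nat -> nat) (K s j : nat) (x : nat -> Z) : Prop :=
  (j <= count (blocked K s (scale r j) x) K)%nat /\
  (count (blocked K s (scale r (S j)) x) K <= j)%nat.

(** A point outside strata [0, ..., n] has at least [n + 1] blocked directions at scale [n + 1]; for
    [n = K] there are too few directions. *)
Lemma stratum_cover (r : nat -> nat) (K s : nat) (x : nat -> Z) :
  exists j, (j <= K)%nat /\ stratum r K s j x.
Proof.
  assert (H : forall n, (S n <= count (blocked K s (scale r (S n)) x) K)%nat \/
                        exists j, (j <= n)%nat /\ stratum r K s j x).
  { induction n as [|n [IH|(j & ? & ?)]].
    - destruct (le_lt_dec 1 (count (blocked K s (scale r 1) x) K)); [now left|].
      right. exists 0%nat. unfold stratum. lia.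
    - destruct (le_lt_dec (S (S n)) (count (blocked K s (scale r (S (S n))) x) K));
        [now left|].
      right. exists (S n). unfold stratum. lia.
    - right. exists j. auto. }
  destruct (H K) as [HK|]; trivial.
  pose proof (count_le (blocked K s (scale r (S K)) x) K). lia.
Qed.

Definition stratum_step (r : nat -> nat) (K s j : nat) (x x' : nat -> Z) : Prop :=
  stratum r K s j x /\ stratum r K s j x' /\
  forall k, (Z.of_nat (S k) * Z.abs (x k - x' k) <= Z.of_nat (r j))%Z.

Lemma stratum_step_le (r : nat -> nat) (K s j : nat) (x x' : nat -> Z) :
  stratum_step r K s j x x' -> forall k, (Z.abs (x k - x' k) <= Z.of_nat (r j))%Z.
Proof. intros (_ & _ & H) k. specialize (H k). nia. Qed.

(** Blocked directions only accumulate as the scale grows, and in stratum [j] their number does not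
    grow from scale [j] to [j + 1], so the two sets coincide. *)
Lemma stratum_saturated (r : nat -> nat) (K s j : nat) (x : nat -> Z) :
  stratum r K s j x -> forall i, (i < K)%nat ->
  blocked K s (scale r (S j)) x i -> blocked K s (scale r j) x i.
Proof.
  intros [H1 H2]. apply count_incl_rev; [|lia].
  intros i _. apply (blocked_step K s _ 0); [simpl; lia|].
  intros k. lia.
Qed.

(** A step carries a direction blocked at scale [j] to one blocked at scale [j + 1]; saturation
    brings it back to scale [j]. *)
Lemma stratum_step_blocked (r : nat -> nat) (K s j : nat) (x x' : nat -> Z) :
  stratum_step r K s j x x' -> forall i, (i < K)%nat ->
  blocked K s (scale r j) x i <-> blocked K s (scale r j) x' i.
Proof.
  intros Hst. assert (Hle := stratum_step_le _ _ _ _ _ _ Hst).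
  destruct Hst as (Hx & Hx' & _). intros i Hi. split; intros Hb;
    (apply stratum_saturated; trivial);
    (eapply (blocked_step K s (scale r j) (r j)); [simpl; lia| |exact Hb]);
    intros k; specialize (Hle k); lia.
Qed.

(** This closure grows at its far end, so inductions keep the starting point fixed. *)
Notation stratum_conn r K s j :=
  (clos_refl_trans_n1 (nat -> Z) (stratum_step r K s j)).

Lemma stratum_conn_blocked (r : nat -> nat) (K s j : nat) (x x' : nat -> Z) :
  stratum_conn r K s j x x' -> forall i, (i < K)%nat ->
  blocked K s (scale r j) x i <-> blocked K s (scale r j) x' i.
Proof.
  induction 1 as [|y z Hst _ IH]; intros i Hi; [reflexivity|].
  rewrite IH by trivial. exact (stratum_step_blocked _ _ _ _ _ _ Hst i Hi).
Qed.

(** After each step direction [i] is still blocked by some wall, and rigidity identifies it with the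
    original one. *)
Lemma stratum_conn_wall (r : nat -> nat) (K s j : nat) (x x' : nat -> Z)
  (i : nat) (u : nat -> Z) (q : Z) :
  (scale r (S j) <= s)%nat -> (i < K)%nat -> near_wall K s (scale r j) x i u q ->
  stratum_conn r K s j x x' -> near_wall K s (scale r j) x' i u q.
Proof.
  intros Hs Hi Hn Hc.
  assert (Hb : blocked K s (scale r j) x i) by (now exists u, q).
  induction Hc as [|y z Hst Hc IH]; trivial.
  apply (stratum_conn_blocked _ _ _ _ _ _ Hc i Hi) in Hb.
  apply (stratum_step_blocked _ _ _ _ _ _ Hst i Hi) in Hb as (u' & q' & Hb).
  exact (near_wall_rigid K s _ (r j) y z i u u' q q' Hs
           (stratum_step_le _ _ _ _ _ _ Hst) IH Hb).
Qed.

(* In stratum [0], [K = r 0] makes each step too short to change a coordinate [k >= K];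
   in the others, some direction is blocked and the wall responsible for it never changes. *)
Lemma stratum_conn_fiber (r : nat -> nat) (K s j : nat) (x x' : nat -> Z) :
  K = r 0%nat -> (scale r (S j) <= s)%nat -> stratum_conn r K s j x x' ->
  forall k, (K <= k < s)%nat -> (Z.abs (x k - x' k) <= Z.of_nat (2 * scale r j))%Z.
Proof.
  intros HK Hs Hc k Hk. destruct j as [|j].
  - enough (x k = x' k) by lia.
    induction Hc as [|y z (_ & _ & Hst) _ IH]; trivial.
    rewrite IH. specialize (Hst k). rewrite <- HK in Hst. nia.
  (* Only a nonempty chain places [x] in the stratum. *)
  - assert (Hx : x = x' \/ stratum r K s (S j) x).
    { clear Hk. induction Hc as [|y z Hst Hc [<-|IH]]; [now left| |now right].
      right. apply Hst. }
    destruct Hx as [<-|[Hx _]]; [lia|].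
    destruct (count_pos (blocked K s (scale r (S j)) x) K) as (i & Hi & u & q & Hn); [lia|].
    assert (Hn' := stratum_conn_wall r K s (S j) x x' i u q Hs Hi Hn Hc).
    destruct Hn as [Hn _], Hn' as [Hn' _].
    specialize (Hn k Hk). specialize (Hn' k Hk). lia.
Qed.

(* A free coordinate is trapped between two walls over the starting point. *)
Lemma stratum_conn_bounded (r : nat -> nat) (K s j : nat) (x x' : nat -> Z) :
  K = r 0%nat -> (scale r (S j) <= s)%nat -> stratum_conn r K s j x x' ->
  forall k, (k < s)%nat -> (Z.abs (x k - x' k) <= period K s)%Z.
Proof.
  intros HK Hs Hc k Hk. assert (Hp := period_gt K s).
  destruct (le_lt_dec K k) as [HKk|HkK].
  { assert (H := stratum_conn_fiber r K s j x x' HK Hs Hc k ltac:(lia)). simpl in Hs. lia. }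
  destruct (classic (blocked K s (scale r j) x k)) as [(u & q & Hn)|Hfree].
  { assert (Hn' := stratum_conn_wall r K s j x x' k u q Hs HkK Hn Hc).
    destruct Hn as [_ Hn], Hn' as [_ Hn']. simpl in Hs. lia. }
  set (t := (x k + offset K s x)%Z).
  set (q := (t / period K s)%Z).
  assert (Hq : (period K s * q <= t < period K s * (q + 1))%Z).
  { assert (H := Z.div_mod t (period K s) ltac:(lia)).
    assert (H' := Z.mod_pos_bound t (period K s) ltac:(lia)). fold q in H. lia. }
  enough (Hq' : (period K s * q <= x' k + offset K s x < period K s * (q + 1))%Z) by lia.
  induction Hc as [|y z Hst Hc IH]; [exact Hq|].
  (* By [stratum_conn_fiber], [y] stays within [2 * scale r j] of [x] on the coordinates from [K] to
     [s], so the walls over [x] itself count as nearby. Being free at [y] means staying farther from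
     them than [scale r (S j)], more than one step can cross. *)
  assert (Hwall : forall p, (Z.of_nat (scale r (S j)) <
                             Z.abs (y k + offset K s x - period K s * p))%Z).
  { intros p. apply Z.nle_gt. intros Hle. apply Hfree.
    apply (stratum_conn_blocked _ _ _ _ _ _ Hc k HkK).
    apply stratum_saturated; [apply Hst|trivial|]. exists x, p. split; [|exact Hle].
    intros i Hi. assert (H := stratum_conn_fiber r K s j x y HK Hs Hc i Hi). simpl; lia. }
  assert (H0 := Hwall q). assert (H1 := Hwall (q + 1)%Z).
  assert (Hd := stratum_step_le _ _ _ _ _ _ Hst k).
  simpl in H0, H1. lia.
Qed.

(** * The metric of the restricted product *)

Fixpoint nsum (t : nat -> nat) (n : nat) : nat :=
  match n with
  | O => O
  | S n' => nsum t n' + t n'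
  end%nat.

Lemma nsum_stable (t : nat -> nat) (N n : nat) :
  (forall k, (N <= k)%nat -> t k = 0%nat) -> (N <= n)%nat -> nsum t n = nsum t N.
Proof. intros Ht. induction 1; simpl; [reflexivity|]. rewrite Ht; lia. Qed.

Lemma nsum_ge (t : nat -> nat) (n k : nat) : (k < n)%nat -> (t k <= nsum t n)%nat.
Proof. induction 1; simpl; lia. Qed.

Lemma nsum_le (t : nat -> nat) (n c : nat) :
  (forall k, (k < n)%nat -> (t k <= c)%nat) -> (nsum t n <= n * c)%nat.
Proof.
  induction n; intros H; simpl; [lia|].
  assert (H1 := H n ltac:(lia)). assert (nsum t n <= n * c)%nat by auto. lia.
Qed.

Lemma infinite_sum_nsum (t : nat -> nat) (N : nat) :
  (forall k, (N <= k)%nat -> t k = 0%nat) ->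
  infinite_sum (fun k => INR (t k)) (INR (nsum t N)).
Proof.
  intros Ht eps Heps. exists N. intros n Hn.
  (* [sum_f_R0] includes its upper index, hence [S n]. *)
  assert (E : sum_f_R0 (fun k => INR (t k)) n = INR (nsum t (S n))).
  { clear. induction n.
    - simpl. lra.
    - rewrite tech5, IHn, <- plus_INR. reflexivity. }
  rewrite E, (nsum_stable t N (S n)) by (trivial; lia).
  now rewrite Rdist_eq.
Qed.

(** The series has finitely many nonzero terms, and uniqueness of limits identifies the value picked
    by [epsilon]. *)
Lemma rp_dist_nsum (V : nat -> Type) (adj : forall k, V k -> V k -> Prop)
  (base : forall k, V k) (a b : restricted_product V base) (N : nat) :
  (forall k, connected (adj k)) ->
  (forall k, (N <= k)%nat -> proj1_sig a k = proj1_sig b k) ->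
  rp_dist V base (fun k => graph_dist (adj k)) a b =
  INR (nsum (fun k => S k * walk_dist (adj k) (proj1_sig a k) (proj1_sig b k))%nat N).
Proof.
  intros Hc HN.
  set (t := fun k => (S k * walk_dist (adj k) (proj1_sig a k) (proj1_sig b k))%nat).
  assert (E : (fun k => INR (S k) * graph_dist (adj k) (proj1_sig a k) (proj1_sig b k)) =
              (fun k => INR (t k))).
  { extensionality k. unfold t. rewrite mult_INR. reflexivity. }
  unfold rp_dist. rewrite E.
  assert (Hs : infinite_sum (fun k => INR (t k)) (INR (nsum t N))).
  { apply infinite_sum_nsum. intros k Hk. unfold t.
    rewrite HN, walk_dist_refl by trivial. lia. }
  apply (uniqueness_sum (fun k => INR (t k))); trivial.
  apply epsilon_spec. now exists (INR (nsum t N)).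
Qed.

Lemma restricted_product_agree (V : nat -> Type) (base : forall k, V k)
  (a b : restricted_product V base) :
  exists N, forall k, (N <= k)%nat -> proj1_sig a k = proj1_sig b k.
Proof.
  destruct a as [a [N Ha]], b as [b [N' Hb]]. exists (N + N')%nat.
  intros k Hk. simpl. rewrite Ha, Hb by lia. reflexivity.
Qed.

Lemma rp_dist_coord (V : nat -> Type) (adj : forall k, V k -> V k -> Prop)
  (base : forall k, V k) (a b : restricted_product V base) (r : nat) :
  (forall k, connected (adj k)) ->
  rp_dist V base (fun k => graph_dist (adj k)) a b <= INR r ->
  forall k, (S k * walk_dist (adj k) (proj1_sig a k) (proj1_sig b k) <= r)%nat.
Proof.
  intros Hc Hr k. destruct (restricted_product_agree V base a b) as [N HN].
  rewrite (rp_dist_nsum V adj base a b N Hc HN) in Hr. apply INR_le in Hr.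
  destruct (le_lt_dec N k) as [Hk|Hk].
  - rewrite HN, walk_dist_refl by trivial. lia.
  - etransitivity; [|exact Hr].
    exact (nsum_ge (fun k => S k * walk_dist (adj k) (proj1_sig a k) (proj1_sig b k))%nat
             N k Hk).
Qed.

(** * Property C from bounded components *)

Lemma clos_refl_trans_sym {X : Type} (R : relation X) (x y : X) :
  (forall x y, R x y -> R y x) -> clos_refl_trans X R x y -> clos_refl_trans X R y x.
Proof.
  intros Hs. induction 1;
    [now apply rt_step, Hs|apply rt_refl|now apply rt_trans with y].
Qed.

(** Reflexive even at points outside [P], so the families below take only classes of points of
    [P]. *)
Definition conn_in {X : Type} (d : X -> X -> R) (P : X -> Prop) (r : nat) : relation X :=
  clos_refl_trans X (fun a b => P a /\ P b /\ d a b <= INR r).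

Lemma conn_in_stays {X : Type} (d : X -> X -> R) (P : X -> Prop) (r : nat) (x y : X) :
  conn_in d P r x y -> P x -> P y.
Proof. induction 1; intuition. Qed.

Lemma property_C_of_components {X : Type} (d : X -> X -> R) :
  (forall a b, d a b = d b a) -> (forall a b, exists n, d a b = INR n) ->
  (forall r : nat -> nat, exists (n : nat) (P : nat -> X -> Prop),
     (forall x, exists j, (j <= n)%nat /\ P j x) /\
     (forall j, (j <= n)%nat ->
        exists M, forall x y, conn_in d (P j) (r j) x y -> d x y <= M)) ->
  asymptotic_property_C d.
Proof.
  intros Hsym Hint H Rs _ _.
  set (r := fun j => proj1_sig (constructive_indefinite_description _ (INR_unbounded (Rs j)))).
  assert (Hr : forall j, Rs j < INR (r j)).
  { intros j. exact (proj2_sig (constructive_indefinite_description _ (INR_unbounded (Rs j)))). }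
  destruct (H r) as (n & P & Hcov & Hbd). clear H.
  assert (Hsc : forall j x y, conn_in d (P j) (r j) x y -> conn_in d (P j) (r j) y x).
  { intros j x y. apply clos_refl_trans_sym. intros u v. rewrite (Hsym u v). tauto. }
  exists n, (fun j A => exists a, P j a /\ A = conn_in d (P j) (r j) a). split.
  - intros j Hj. split; [|split].
    + destruct (Hbd j Hj) as [M HM]. exists M.
      intros A (a & _ & ->) x y Hx Hy. apply HM.
      eapply rt_trans; [apply Hsc; exact Hx|exact Hy].
    + intros A (a & _ & ->). exists a. apply rt_refl.
    (* Points of distinct classes are at an integer distance above [r j], hence at least
       [r j + 1]. *)
    + intros A B (a & Ha & ->) (b & Hb & ->) Hne. exists (INR (S (r j))). split.
      { rewrite S_INR. specialize (Hr j). lra. }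
      intros x y Hx Hy. destruct (Hint x y) as [m Hm]. rewrite Hm. apply le_INR.
      apply Nat.nlt_ge. intros Hlt. apply Hne.
      assert (Hxy : conn_in d (P j) (r j) x y).
      { apply rt_step. repeat split.
        - exact (conn_in_stays _ _ _ _ _ Hx Ha).
        - exact (conn_in_stays _ _ _ _ _ Hy Hb).
        - rewrite Hm. apply le_INR. lia. }
      assert (Hab : conn_in d (P j) (r j) a b).
      { eapply rt_trans; [exact Hx|]. eapply rt_trans; [exact Hxy|].
        apply Hsc; exact Hy. }
      extensionality c. apply propositional_extensionality. split; intros Hc.
      * eapply rt_trans; [apply Hsc; exact Hab|exact Hc].
      * eapply rt_trans; [exact Hab|exact Hc].
  - intros x. destruct (Hcov x) as (j & Hj & Hx).
    exists j, (conn_in d (P j) (r j) x). split; [|split]; trivial.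
    + now exists x.
    + apply rt_refl.
Qed.

(** * Products of trees *)

Definition heights (V : nat -> Type) (adj : forall k, V k -> V k -> Prop)
  (base : forall k, V k) (a : restricted_product V base) (k : nat) : Z :=
  Z.of_nat (walk_dist (adj k) (base k) (proj1_sig a k)).

Notation product_dist V adj base := (rp_dist V base (fun k => graph_dist (adj k))).

Notation product_stratum V adj base r K s j :=
  (fun a => stratum r K s j (heights V adj base a)).

(** Height is 1-Lipschitz in each coordinate, so chains in the product project to chains of integer
    sequences. *)
Lemma heights_conn (V : nat -> Type) (adj : forall k, V k -> V k -> Prop)
  (base : forall k, V k) (r : nat -> nat) (K s j : nat) (x y : restricted_product V base) :
  (forall k, is_tree (adj k)) ->
  conn_in (product_dist V adj base) (product_stratum V adj base r K s j) (r j) x y ->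
  stratum_conn r K s j (heights V adj base x) (heights V adj base y).
Proof.
  intros Ht Hc. apply clos_rt_rtn1 in Hc.
  induction Hc as [|y z (Hy & Hz & Hd) _ IH]; [constructor|].
  econstructor; [|exact IH]. repeat split; try apply Hy; try apply Hz.
  intros k. apply (rp_dist_coord V adj base y z (r j)) with (k := k) in Hd;
    [|intros i; apply Ht].
  unfold heights.
  assert (H1 := walk_dist_triangle (adj k) (base k) (proj1_sig y k) (proj1_sig z k)
                  (proj1 (proj2 (Ht k)))).
  assert (H2 := walk_dist_triangle (adj k) (base k) (proj1_sig z k) (proj1_sig y k)
                  (proj1 (proj2 (Ht k)))).
  rewrite (walk_dist_sym (adj k) (proj1_sig z k)) in H2 by apply Ht.
  nia.
Qed.

Lemma product_stratum_bounded (V : nat -> Type) (adj : forall k, V k -> V k -> Prop)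
  (base : forall k, V k) (r : nat -> nat) (s j : nat) :
  (forall k, is_tree (adj k)) -> (scale r (S j) <= s)%nat ->
  exists M, forall x y,
    conn_in (product_dist V adj base) (product_stratum V adj base r (r 0%nat) s j) (r j) x y ->
    product_dist V adj base x y <= M.
Proof.
  intros Ht Hs.
  assert (Hconn : forall k, connected (adj k)) by (intros k; apply Ht).
  set (L := Z.to_nat (period (r 0%nat) s)).
  (* With [h] as below, [x] lies at most [L + r j] and [y] at most [2 * L + r j] above level [h];
     [M] bounds the sum. *)
  set (M := (2 * (2 * L + r j))%nat).
  exists (INR (s * (s * M))). intros x y Hxy.
  (* For [k >= s >= r j] the weight [k + 1] exceeds the step length, so the coordinate is frozen. *)
  assert (Hfar : forall k, (s <= k)%nat -> proj1_sig x k = proj1_sig y k).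
  { intros k Hk. apply clos_rt_rtn1 in Hxy.
    induction Hxy as [|y z (_ & _ & Hd) _ IH]; trivial. rewrite IH.
    apply (rp_dist_coord V adj base y z (r j) Hconn) with (k := k) in Hd.
    apply (walk_dist_0 (adj k)); [apply Ht|]. simpl in Hs. nia. }
  rewrite (rp_dist_nsum V adj base x y s Hconn Hfar).
  apply le_INR, nsum_le. intros k Hk.
  enough (walk_dist (adj k) (proj1_sig x k) (proj1_sig y k) <= M)%nat by nia.
  set (f := fun a : restricted_product V base =>
              walk_dist (adj k) (base k) (proj1_sig a k)).
  assert (Hheight : forall z,
    conn_in (product_dist V adj base) (product_stratum V adj base r (r 0%nat) s j) (r j) x z ->
    (f x <= f z + L /\ f z <= f x + L)%nat).
  { intros z Hz. apply heights_conn in Hz; trivial.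
    assert (H := stratum_conn_bounded r (r 0%nat) s j _ _ eq_refl Hs Hz k Hk).
    unfold heights in H. unfold f, L. lia. }
  (* Chain points have height at least [f x - L], and a geodesic between consecutive ones dips at
     most [r j] lower. *)
  set (h := (f x - L - r j)%nat).
  assert (Hw : exists n, Walk (adj_above (adj k) (base k) h) (proj1_sig x k) (proj1_sig y k) n).
  { clear Hfar. apply clos_rt_rtn1 in Hxy.
    induction Hxy as [|y z (_ & _ & Hd) Hc [n IH]]; [exists 0%nat; apply walk_nil|].
    apply clos_rtn1_rt in Hc. apply Hheight in Hc.
    apply (rp_dist_coord V adj base y z (r j) Hconn) with (k := k) in Hd.
    eexists. eapply Walk_trans; [exact IH|].
    eapply walk_stays_above; [apply Ht|apply walk_dist_spec, Ht|].
    fold (f y). unfold h. nia. }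
  destruct Hw as [n Hw]. destruct (Hheight y Hxy) as [Hy Hy'].
  assert (H := walk_dist_above (adj k) (base k) _ _ h n (Ht k) Hw).
  fold (f x) (f y) in H. unfold h, M in *. lia.
Qed.

Theorem theorem3p3 (V : nat -> Type) (adj : forall k, V k -> V k -> Prop)
  (base : forall k, V k) (Htree : forall k, is_tree (adj k)) :
  asymptotic_property_C
    (rp_dist V base (fun k => graph_dist (adj k))).
Proof.
  assert (Hconn : forall k, connected (adj k)) by (intros k; apply Htree).
  apply property_C_of_components.
  - intros a b. unfold rp_dist. do 2 f_equal. extensionality k.
    unfold graph_dist. fold (walk_dist (adj k) (proj1_sig a k) (proj1_sig b k)).
    fold (walk_dist (adj k) (proj1_sig b k) (proj1_sig a k)).
    rewrite walk_dist_sym by apply Htree. reflexivity.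
  - intros a b. destruct (restricted_product_agree V base a b) as [N HN].
    eexists. exact (rp_dist_nsum V adj base a b N Hconn HN).
  (* This [s] is at least [scale r (S j)] for every stratum [j <= K]. *)
  - intros r. set (K := r 0%nat). set (s := scale r (S K)).
    exists K, (fun j => product_stratum V adj base r K s j). split.
    + intros a. apply stratum_cover.
    + intros j Hj. apply product_stratum_bounded; trivial.
      apply scale_mono. lia.
Qed.
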